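(* Let $\widehat L:BUC_\eta\to\mathbb{R}^n$ be a bounded linear operator. Then, with $\Omega=\{\lambda\in\mathbb{C}:\mathrm{Re}(\lambda)>-\eta\}$, $$\sigma(A+L)\cap\Omega=\sigma_P((A+L)_0)\cap\Omega=\{\lambda\in\Omega:\det(\Delta(\lambda))=0\},$$ where $\Delta(\lambda)=\lambda I-\widehat L(e^{\lambda\cdot}I)\in M_n(\mathbb{C})$.
   Context: Fix an integer $n\ge1$ and a real $\eta>0$. $BUC_\eta$ is the Banach space of all $\varphi\in C((-\infty,0],\mathbb{R}^n)$ such that $\theta\mapsto e^{\eta\theta}\varphi(\theta)$ is bounded and uniformly continuous, with norm $\|\varphi\|_\eta=\sup_{\theta\le0}e^{\eta\theta}\|\varphi(\theta)\|$; $BUC_\eta^1=\{\varphi\in C^1:\varphi,\varphi'\in BUC_\eta\}$. $X=\mathbb{R}^n\times BUC_\eta$ with norm $\|(\alpha,\varphi)\|=\|\alpha\|+\|\varphi\|_\eta$. $A:D(A)\subset X\to X$, $A(0,\varphi)=(-\varphi'(0),\varphi')$, $D(A)=\{0_{\mathbb{R}^n}\}\times BUC_\eta^1$, whose closure is $\overline{D(A)}=\{0_{\mathbb{R}^n}\}\times BUC_\eta$. $L:\overline{D(A)}\to X$, $L(0,\varphi)=(\widehat L(\varphi),0)$. $(A+L)_0$ is the part of $A+L$ in $\overline{D(A)}$: $(A+L)_0(0,\varphi)=(0,\varphi')$ with domain $\{(0,\varphi):\varphi\in BUC^1_\eta,\ \varphi'(0)=\widehat L(\varphi)\}$. For spectral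 questions all spaces and operators are complexified. $\sigma$ denotes the spectrum and $\sigma_P$ the point spectrum (set of eigenvalues). $\widehat L(e^{\lambda\cdot}I)$ is the matrix $v\mapsto\widehat L(\theta\mapsto e^{\lambda\theta}v)$. *)

(* Defs.v *)
From HB Require Import structures.
From mathcomp Require Import all_boot all_order all_algebra.
From mathcomp Require Import complex lra.
From mathcomp Require Import all_classical all_reals all_analysis.
Import Order.TTheory GRing.Theory Num.Theory.
Import numFieldNormedType.Exports.

Set Implicit Arguments.
Unset Strict Implicit.
Unset Printing Implicit Defensive.

Local Open Scope classical_set_scope.
Local Open Scope ring_scope.

(* The half-line (-oo, 0], as a subtype of R with the induced topology and
   uniformity. *)
Notation Nonpos R := (set_type [set x : R | x <= 0]).

Definition nonpos0 (R : realType) : Nonpos R :=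
  exist _ 0 (mem_set (lexx (0 : R))).

(* [scalars R K] is the interface through which K = R and K = R[i] are treated
   uniformly, so that the complexified spaces and operators are given by the
   same definitions as the real ones.  It is only instantiated by [real_scalars]
   and [complex_scalars]. *)
Record scalars (R : realType) (K : numFieldType) := Scalars {
  emb : {rmorphism R -> K};
  re : K -> R;
  embK : cancel emb re;
  reK : {in Num.real, cancel re emb};
  ler_emb : {mono emb : x y / x <= y}
}.

Section ScalarsTheory.
Variables (R : realType) (K : numFieldType) (k : scalars R K).

Lemma emb_ge0 x : (0 <= emb k x) = (0 <= x).
Proof. by have := ler_emb k 0 x; rewrite rmorph0. Qed.

Lemma emb_gt0 x : (0 < emb k x) = (0 < x).
Proof. by rewrite !lt_def fmorph_eq0 emb_ge0. Qed.

Lemma norm_reK (V : normedZmodType K) (v : V) : emb k (re k `|v|) = `|v|.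
Proof. by rewrite reK// realE normr_ge0. Qed.

Lemma norm_emb x : `|emb k x| = emb k `|x|.
Proof.
have [x0|x0] := lerP 0 x; first by rewrite !ger0_norm ?emb_ge0.
by rewrite -normrN -rmorphN -[`|x|]normrN !ger0_norm ?emb_ge0// oppr_ge0 ltW.
Qed.

Lemma re_norm_ge0 (V : normedZmodType K) (v : V) : 0 <= re k `|v|.
Proof. by rewrite -emb_ge0 norm_reK. Qed.

Lemma re_normZ (V : normedModType K) (a : R) (v : V) : 0 <= a ->
  re k `|emb k a *: v| = a * re k `|v|.
Proof.
move=> a0; apply: (can_inj (embK k)); rewrite norm_reK rmorphM norm_reK.
by rewrite normrZ norm_emb ger0_norm.
Qed.

Lemma unif_NonposP (V : normedModType K) (f : Nonpos R -> V) :
  unif_continuous f <->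
  forall e : R, 0 < e -> exists2 d : R, 0 < d &
    forall s t : Nonpos R, `|\val s - \val t| < d -> `|f s - f t| < emb k e.
Proof.
split=> [uf e e0|uf E].
  have : entourage [set xy : V * V | ball xy.1 (emb k e) xy.2].
    by rewrite -entourage_ballE; exists (emb k e) => //=; rewrite emb_gt0.
  move=> /uf; rewrite /nbhs/=; rewrite -entourage_ballE => -[d/= d0 dE].
  exists d => // s t st; have := dE (s, t) st.
  by rewrite /= -ball_normE.
rewrite -[X in X E -> _]entourage_ballE => -[e /= e0 eE].
have er : e \is Num.real by rewrite realE ltW.
have [] := uf (re k e); first by rewrite -emb_gt0 (reK k er).
move=> d d0 h; rewrite /nbhs/= -entourage_ballE; exists d => //= -[s t]/= st.
by apply: eE => /=; rewrite -ball_normE/= -(reK k er); exact: h.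
Qed.

Lemma bounded_NonposP (V : normedModType K) (f : Nonpos R -> V) :
  bounded_fun f <-> exists M : R, forall t, `|f t| <= emb k M.
Proof.
have PF : ProperFilter (globally [set: Nonpos R]).
  exact: (@globally_properfilter _ _ (nonpos0 R)).
split=> [/ex_bound[M fM]|[M fM]]; last first.
  by apply/ex_bound; exists (emb k M) => t _; exact: fM.
have Mr : M \is Num.real.
  by apply/ger0_real/(le_trans (normr_ge0 (f (nonpos0 R))))/fM.
by exists (re k M) => t; rewrite reK//; exact: fM.
Qed.

End ScalarsTheory.

Section RealComplexScalars.
Variable R : realType.

Definition real_scalars : scalars R R :=
  @Scalars R R (idfun : {rmorphism R -> R}) idfun
    (fun=> erefl) (fun _ _ => erefl) (fun _ _ => erefl).

Definition complex_scalars : scalars R R[i] :=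
  @Scalars R R[i] (real_complex R) (@complex.Re R)
    (fun=> erefl) (@RRe_real R) (@lecR R).

End RealComplexScalars.

Section BUC.
Variables (R : realType) (K : numFieldType) (k : scalars R K).
Variables (n : nat) (eta : R).

Definition weighted (phi : Nonpos R -> 'cV[K]_n) (theta : Nonpos R) : 'cV[K]_n :=
  emb k (expR (eta * \val theta)) *: phi theta.

Definition is_BUC : {pred (Nonpos R -> 'cV[K]_n)} := fun phi =>
  `[< [/\ continuous phi, bounded_fun (weighted phi)
        & unif_continuous (weighted phi)] >].

Record BUC := MkBUC { BUC_fun :> Nonpos R -> 'cV[K]_n ; _ : BUC_fun \in is_BUC }.

HB.instance Definition _ := [isSub for BUC_fun].
HB.instance Definition _ := [Choice of BUC by <:].

Lemma is_BUCP (phi : Nonpos R -> 'cV[K]_n) :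
  reflect [/\ continuous phi, bounded_fun (weighted phi)
    & unif_continuous (weighted phi)] (phi \in is_BUC).
Proof. exact: asboolP. Qed.

Lemma weightedP (a : K) (phi psi : Nonpos R -> 'cV[K]_n) :
  weighted (a *: phi + psi) = a *: weighted phi + weighted psi.
Proof.
by apply/funext => t; rewrite /weighted !fctE scalerDr !scalerA mulrC.
Qed.

Lemma weighted0 : weighted 0 = 0.
Proof. by apply/funext => t; exact: scaler0. Qed.

Lemma is_BUC_submod : submod_closed is_BUC.
Proof.
split=> [|a phi psi /is_BUCP[cphi bphi uphi] /is_BUCP[cpsi bpsi upsi]].
  apply/is_BUCP; split; rewrite ?weighted0.
  - exact: (@cst_continuous _ _ (0 : 'cV[K]_n)).
  - by apply/(bounded_NonposP k); exists 0 => t; rewrite normr0 rmorph0.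
  - apply/(unif_NonposP k) => e e0; exists 1 => // s t _.
    by rewrite subrr normr0 emb_gt0.
apply/is_BUCP; split; rewrite ?weightedP.
- move=> t; apply: (@cvgD _ _ _ _ (nbhs_filter t)); last exact: cpsi.
  by apply: (@cvgZl_tmp _ _ _ _ (nbhs_filter t)); exact: cphi.
- have [M phiM] := (bounded_NonposP k _).1 bphi.
  have [N psiN] := (bounded_NonposP k _).1 bpsi.
  apply/(bounded_NonposP k); exists (re k `|a| * M + N) => t.
  rewrite rmorphD rmorphM/= norm_reK (le_trans (ler_normD _ _))//.
  by rewrite lerD// normrZ ler_wpM2l.
- move/(unif_NonposP k) in uphi; move/(unif_NonposP k) in upsi.
  apply/(unif_NonposP k) => e e0.
  have a1 : 0 < 1 + re k `|a| by rewrite ltr_wpDr ?re_norm_ge0.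
  have [d1 d10 h1] := uphi (e / 2 / (1 + re k `|a|)) ltac:(by rewrite !divr_gt0).
  have [d2 d20 h2] := upsi (e / 2) ltac:(by rewrite divr_gt0).
  exists (Num.min d1 d2); first by rewrite lt_min d10.
  move=> s t; rewrite lt_min => /andP[/h1 {}h1 /h2 {}h2].
  rewrite !fctE opprD addrACA -scalerBr (le_lt_trans (ler_normD _ _))//.
  rewrite (splitr e) rmorphD/= ler_ltD// normrZ.
  rewrite (le_trans (ler_wpM2l (normr_ge0 _) (ltW h1)))//.
  rewrite -[X in X * _](norm_reK k) -rmorphM ler_emb mulrCA ler_piMr ?divr_ge0 ?ltW//.
  by rewrite ltr_pdivrMr// mul1r ltrDr.
Qed.

HB.instance Definition _ :=
  GRing.isSubmodClosed.Build K (Nonpos R -> 'cV[K]_n) is_BUC is_BUC_submod.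
HB.instance Definition _ := [SubChoice_isSubLmodule of BUC by <:].

Definition BUC_norm (phi : BUC) : K := emb k
  (sup (range (fun theta : Nonpos R => expR (eta * \val theta) * re k `|phi theta|))).
End BUC.

Section BUCNorm.
Variables (R : realType) (K : numFieldType) (k : scalars R K).
Variables (n : nat) (eta : R).
Implicit Types phi psi : BUC k n eta.

Let wnorms phi := range (fun theta : Nonpos R =>
  expR (eta * \val theta) * re k `|phi theta|).

Let wnormsE phi theta :
  expR (eta * \val theta) * re k `|phi theta| = re k `|weighted k eta phi theta|.
Proof. by rewrite re_normZ// expR_ge0. Qed.

Let has_sup_wnorms phi : has_sup (wnorms phi).
Proof.
split; first by eexists; exists (nonpos0 R).
have [/is_BUCP[_ /(bounded_NonposP k)[M phiM] _]] := conj (valP phi) I.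
exists M => _ [t _ <-]; rewrite wnormsE -(ler_emb k) norm_reK; exact: phiM.
Qed.

Let le_wnorms phi theta :
  expR (eta * \val theta) * re k `|phi theta| <= sup (wnorms phi).
Proof. by apply: (sup_upper_bound (has_sup_wnorms phi)); exists theta. Qed.

Let wnorms_le phi (M : R) :
  (forall theta, expR (eta * \val theta) * re k `|phi theta| <= M) ->
  sup (wnorms phi) <= M.
Proof.
move=> h; apply: ge_sup; first by have [] := has_sup_wnorms phi.
by move=> _ [t _ <-]; exact: h.
Qed.

Let re_normD (u v : 'cV[K]_n) : re k `|u + v| <= re k `|u| + re k `|v|.
Proof. by rewrite -(ler_emb k) rmorphD !norm_reK ler_normD. Qed.

Let re_normZK (a : K) (v : 'cV[K]_n) : re k `|a *: v| = re k `|a| * re k `|v|.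
Proof.
by apply: (can_inj (embK k)); rewrite rmorphM !norm_reK normrZ.
Qed.

Lemma BUC_normD phi psi : BUC_norm (phi + psi) <= BUC_norm phi + BUC_norm psi.
Proof.
rewrite -rmorphD ler_emb; apply: wnorms_le => t.
rewrite (le_trans (ler_wpM2l (expR_ge0 _) (re_normD (phi t) (psi t))))//.
by rewrite mulrDr lerD ?le_wnorms.
Qed.

Let wnormsZ_le (a : K) phi : sup (wnorms (a *: phi)) <= re k `|a| * sup (wnorms phi).
Proof.
apply: wnorms_le => t; rewrite -[BUC_fun _ t]/(a *: phi t) re_normZK.
by rewrite mulrCA ler_wpM2l ?re_norm_ge0// le_wnorms.
Qed.

Lemma BUC_normZ (a : K) phi : BUC_norm (a *: phi) = `|a| * BUC_norm phi.
Proof.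
rewrite -[X in X * _](norm_reK k) -rmorphM; congr (emb k _).
apply/eqP; rewrite eq_le; apply/andP; split; first exact: wnormsZ_le.
have [->|a0] := eqVneq a 0.
  rewrite normr0 -[X in re k X](rmorph0 (emb k)) embK mul0r.
  by apply: le_trans (le_wnorms _ (nonpos0 R)); rewrite mulr_ge0 ?expR_ge0 ?re_norm_ge0.
have ra0 : 0 < re k `|a| by rewrite -(emb_gt0 k) norm_reK normr_gt0.
rewrite -ler_pdivlMl// -{1}(scalerK a0 phi) (le_trans (wnormsZ_le _ _))//.
rewrite ler_wpM2r//; last first.
  by rewrite -(ler_emb k) fmorphV !norm_reK normfV.
by apply: le_trans (le_wnorms _ (nonpos0 R)); rewrite mulr_ge0 ?expR_ge0 ?re_norm_ge0.
Qed.

Lemma BUC_norm_eq0 phi : BUC_norm phi = 0 -> phi = 0.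
Proof.
move/eqP; rewrite fmorph_eq0 => /eqP s0; apply/val_inj/funext => t.
have := le_wnorms phi t; rewrite s0 pmulr_rle0 ?expR_gt0//.
rewrite -(ler_emb k) norm_reK rmorph0 normr_le0 => /eqP; exact.
Qed.

HB.instance Definition _ := Lmodule_isNormed.Build K (BUC k n eta)
  BUC_normD BUC_normZ BUC_norm_eq0.

End BUCNorm.

Section ComplexNumbers.
Variable R : realType.
Local Notation rc := (real_complex R).

Lemma Re_normK (V : normedZmodType R[i]) (v : V) : rc (complex.Re `|v|) = `|v|.
Proof. exact/RRe_real/normr_real. Qed.

Lemma norm_rc (x : R) : `|rc x| = rc `|x|.
Proof. exact: (norm_emb (complex_scalars R)). Qed.

Lemma ler_norm_Re (z : R[i]) : `|complex.Re z| <= complex.Re `|z|.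
Proof. by rewrite -lecR Re_normK normc_ge_Re. Qed.

Lemma ler_norm_Im (z : R[i]) : `|complex.Im z| <= complex.Re `|z|.
Proof.
rewrite normc_def/= -sqrtr_sqr ler_wsqrtr//.
by rewrite lerDr sqr_ge0.
Qed.

Lemma Re_mul (a : R) z : complex.Re (rc a * z) = a * complex.Re z.
Proof. by case: z => x y /=; rewrite mul0r subr0. Qed.

Lemma Im_mul (a : R) z : complex.Im (rc a * z) = a * complex.Im z.
Proof. by case: z => x y /=; rewrite mul0r addr0. Qed.

Definition cexp (z : R[i]) : R[i] :=
  rc (expR (complex.Re z)) * (cos (complex.Im z) +i* sin (complex.Im z))%C.

Let expR_lip (x y : R) : x <= 0 -> y <= 0 -> `|expR x - expR y| <= `|x - y|.
Proof.
wlog xy : x y / x <= y => [h x0 y0|x0 y0].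
  have /orP[xy|yx] := le_total x y; first exact: h.
  by rewrite distrC [leRHS]distrC; exact: h.
rewrite distrC [leRHS]distrC !ger0_norm ?subr_ge0 ?ler_expR//.
rewrite -[X in _ - expR X](subrK y) expRD -[X in X - _]mul1r -mulrBl.
have h : 1 - expR (x - y) <= y - x.
  by have := expR_ge1Dx (x - y); lra.
rewrite (le_trans (ler_wpM2r (expR_ge0 _) h))//.
by rewrite ler_piMr ?subr_ge0// -expR0 ler_expR.
Qed.

Let lip1 (f df : R -> R) (x y : R) :
  (forall z, is_derive (z : R^o) 1 (f : R^o -> R^o) (df z)) -> (forall z, `|df z| <= 1) ->
  `|f x - f y| <= `|x - y|.
Proof.
move=> fd df1; wlog xy : x y / x <= y => [h|].
  have /orP[xy|yx] := le_total x y; first exact: h.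
  by rewrite distrC [leRHS]distrC; exact: h.
have [z|c _] := @MVT_segment R f df x y xy (fun z _ => fd z).
  apply: continuous_subspaceT => w.
  by apply/differentiable_continuous/derivable1_diffP; have [] := fd w.
rewrite distrC => ->; rewrite normrM [leRHS]distrC.
by rewrite ler_piMl.
Qed.

Let osc_lip (g : R -> R) (a b s t : R) :
  (forall x y, `|g x - g y| <= `|x - y|) -> (forall x, `|g x| <= 1) ->
  0 < a -> s <= 0 -> t <= 0 ->
  `|expR (a * s) * g (b * s) - expR (a * t) * g (b * t)|
    <= (a + `|b|) * `|s - t|.
Proof.
move=> glip g1 a0 s0 t0.
have as0 : a * s <= 0 by rewrite pmulr_rle0.
have at0 : a * t <= 0 by rewrite pmulr_rle0.
rewrite -(subrKA (expR (a * t) * g (b * s))) -mulrBl -mulrBr.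
rewrite (le_trans (ler_normD _ _))// [leRHS]mulrDl lerD// normrM.
  rewrite (le_trans (ler_piMr _ (g1 _)))// (le_trans (expR_lip as0 at0))//.
  by rewrite -mulrBr normrM (gtr0_norm a0).
have e1 : `|expR (a * t)| <= 1 by rewrite ger0_norm ?expR_ge0// -expR0 ler_expR.
rewrite (le_trans (ler_piMl (normr_ge0 _) e1))// (le_trans (glip _ _))//.
by rewrite -mulrBr normrM.
Qed.

Lemma norm_cexp (z : R[i]) : `|cexp z| = rc (expR (complex.Re z)).
Proof.
rewrite /cexp normrM norm_rc (ger0_norm (expR_ge0 _)).
by rewrite [`|(_ +i* _)%C|]normc_def/= cos2Dsin2 sqrtr1 mulr1.
Qed.

Lemma cexpD (z w : R[i]) : cexp (z + w) = cexp z * cexp w.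
Proof.
case: z w => [a b] [c d]; rewrite /cexp/= expRD cosD sinD rmorphM/= mulrACA.
by congr (_ * _); congr (_ +i* _)%C; rewrite addrC [cos b * _]mulrC.
Qed.

Lemma cexp_lip (mu : R[i]) (s t : R) : 0 < complex.Re mu -> s <= 0 -> t <= 0 ->
  `|cexp (mu * rc s) - cexp (mu * rc t)|
    <= rc ((complex.Re mu + `|complex.Im mu|) * 2 * `|s - t|).
Proof.
case: mu => a b /= a0 s0 t0.
have H g : (forall x y, `|g x - g y| <= `|x - y|) -> (forall x, `|g x| <= 1) ->
  `|expR (a * s) * g (b * s) - expR (a * t) * g (b * t)|
    <= (a + `|b|) * `|s - t| by move=> *; exact: osc_lip.
have Hc := H cos (fun x y => lip1 x y (@is_derive_cos R)
  (fun z => ltac:(by rewrite normrN sin_max))) (@cos_max R).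
have Hs := H sin (fun x y => lip1 x y (@is_derive_sin R) (@cos_max R)) (@sin_max R).
have cE r : cexp ((a +i* b)%C * rc r) =
    (expR (a * r) * cos (b * r) +i* (expR (a * r) * sin (b * r)))%C.
  rewrite /cexp/= !mulr0 subr0 add0r.
  by congr (_ +i* _)%C; rewrite mul0r ?subr0 ?addr0.
rewrite !cE.
set u := (X in `|X - _|); set v := (X in `|_ - X|).
have -> : u - v = rc (complex.Re (u - v)) + 'i%C * rc (complex.Im (u - v)).
  by rewrite -complexE.
rewrite (le_trans (ler_normD _ _))// normrM !norm_rc.
rewrite [`|'i%C|]normc_def/= expr0n/= expr1n add0r sqrtr1 mul1r -rmorphD lecR.
by rewrite mulrAC mulr_natr mulr2n lerD.
Qed.

End ComplexNumbers.

Section Operators.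
Variables (K : numFieldType) (X : normedModType K).

(* A possibly unbounded operator; the values of [app] outside [dom] are
   irrelevant. *)
Record operator := Operator { dom : set X ; app :> X -> X }.

Definition op_add (T U : operator) :=
  Operator (dom T `&` dom U) (fun x => T x + U x).

Definition op_part (T : operator) (Y : set X) :=
  Operator [set x | [/\ dom T x, Y x & Y (T x)]] T.

Definition bounded_operator (V W : normedModType K) (f : V -> W) :=
  exists M : K, forall x, `|f x| <= M * `|x|.

Definition resolvent_set (T : operator) : set K :=
  [set lambda | exists S : {linear X -> X}, [/\ bounded_operator S,
     forall y, dom T (S y) /\ lambda *: S y - T (S y) = y
   & forall x, dom T x -> S (lambda *: x - T x) = x]].

Definition spectrum (T : operator) : set K := ~` resolvent_set T.

Definition point_spectrum (T : operator) : set K :=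
  [set lambda | exists x, [/\ dom T x, x != 0 & T x = lambda *: x]].

End Operators.

Section StateSpace.
Variables (R : realType) (K : numFieldType) (k : scalars R K).
Variables (n : nat) (eta : R).

Definition has_deriv (phi psi : Nonpos R -> 'cV[K]_n) :=
  forall theta : Nonpos R,
    (fun s : Nonpos R => emb k (\val s - \val theta)^-1 *: (phi s - phi theta))
      @ theta^' --> psi theta.

Definition BUC1 : set (BUC k n eta) :=
  [set phi | exists psi : BUC k n eta, has_deriv phi psi].

Definition BUC_deriv (phi : BUC k n eta) : BUC k n eta :=
  xget 0 [set psi : BUC k n eta | has_deriv phi psi].

Let nonpos_dnbhs_proper (theta : Nonpos R) : ProperFilter theta^'.
Proof.
apply: Build_ProperFilter_ex => A /nbhs_ballP[d /= d0 dA].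
have td : \val theta - d / 2 \in [set x : R | x <= 0].
  apply/mem_set => /=; have /= := set_mem (valP theta).
  by rewrite /mkset; lra.
pose s : Nonpos R := exist (fun x => x \in [set x : R | x <= 0]) _ td.
exists s; apply: dA.
  change (`|\val theta - (\val theta - d / 2)| < d).
  by rewrite subKr gtr0_norm; lra.
by apply/eqP => /(congr1 val)/= h; lra.
Qed.

Lemma BUC_derivE (phi psi : BUC k n eta) :
  has_deriv phi psi -> BUC_deriv phi = psi.
Proof.
move=> dpsi; have d' : has_deriv phi (BUC_deriv phi).
  exact: (@xgetI _ 0 [set p : BUC k n eta | has_deriv phi p] _ dpsi).
apply/val_inj/funext => t; have PF := nonpos_dnbhs_proper t.
apply: (@cvg_unique _ (@norm_hausdorff K 'cV[K]_n) _ (fmap_proper_filter _ PF)).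
  exact: d'.
exact: dpsi.
Qed.

Definition state : Type := ('cV[K]_n * BUC k n eta)%type.

HB.instance Definition _ := GRing.Lmodule.copy state ('cV[K]_n * BUC k n eta)%type.

(* Not the norm of the library on products, which is the maximum. *)
Definition state_norm (x : state) : K := `|x.1| + `|x.2|.

Lemma state_normD (x y : state) : state_norm (x + y) <= state_norm x + state_norm y.
Proof. by rewrite /state_norm addrACA lerD// ler_normD. Qed.

Lemma state_normZ (a : K) (x : state) : state_norm (a *: x) = `|a| * state_norm x.
Proof. by rewrite /state_norm mulrDr -!normrZ. Qed.

Lemma state_norm_eq0 (x : state) : state_norm x = 0 -> x = 0.
Proof.
by case: x => u v /eqP; rewrite paddr_eq0//= !normr_eq0 => /andP[/eqP-> /eqP->].
Qed.

HB.instance Definition _ :=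
  Lmodule_isNormed.Build K state state_normD state_normZ state_norm_eq0.

Definition A_op : operator state := @Operator K state
  [set x | x.1 = 0 /\ BUC1 x.2]
  (fun x => (- BUC_deriv x.2 (nonpos0 R), BUC_deriv x.2)).

Definition L_op (Lhat : BUC k n eta -> 'cV[K]_n) : operator state := @Operator K state
  (closure (dom A_op)) (fun x => (Lhat x.2, 0)).

Definition AL_op Lhat := op_add A_op (L_op Lhat).

Definition AL0_op Lhat := op_part (AL_op Lhat) (closure (dom A_op)).

End StateSpace.

Section Complexification.
Variables (R : realType) (n : nat) (eta : R).
Local Notation BUC_R := (BUC (real_scalars R) n eta).
Local Notation BUC_C := (BUC (complex_scalars R) n eta).
Local Notation rc := (real_complex R).

Lemma ler_coef_mx_norm (K : numDomainType) m p (v : 'M[K]_(m, p)) i j :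
  `|v i j| <= `|v|.
Proof.
rewrite [leRHS]/Num.norm/= mx_normE -[leLHS]nngE num_le.
exact: (le_bigmax _ (fun ij : 'I_m * 'I_p => `|v ij.1 ij.2|%:nng) (i, j)).
Qed.

Section RealPart.
Variable f : {additive R[i] -> R}.
Hypothesis fZ : forall (a : R) z, f (rc a * z) = a * f z.
Hypothesis f_le : forall z, `|f z| <= complex.Re `|z|.

Let map_f_le (v : 'cV[R[i]]_n) : rc `|map_mx f v| <= `|v|.
Proof.
rewrite -Re_normK lecR [X in X <= _]mx_normrE.
apply/bigmax_leP; split=> [|[i j] _]; first exact: (re_norm_ge0 (complex_scalars R)).
rewrite mxE (le_trans (f_le _))// -lecR !Re_normK.
exact: ler_coef_mx_norm.
Qed.

Let map_fB (u v : 'cV[R[i]]_n) : map_mx f u - map_mx f v = map_mx f (u - v).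
Proof. by rewrite map_mxB. Qed.

Lemma is_BUC_map (phi : BUC_C) :
  (fun theta => map_mx f (phi theta)) \in is_BUC (real_scalars R) eta.
Proof.
have wE t : weighted (real_scalars R) eta (fun s => map_mx f (phi s)) t =
    map_mx f (weighted (complex_scalars R) eta phi t).
  by apply/matrixP => i j; rewrite !mxE fZ.
have /is_BUCP[cphi bphi uphi] := valP phi.
apply/is_BUCP; split.
- move=> t; apply/(@cvgrPdist_lt _ _ _ _ (nbhs_filter t)) => e e0.
  have /(@cvgrPdist_lt _ _ _ _ (nbhs_filter t)) := cphi t.
  move=> /(_ (rc e)); rewrite (emb_gt0 (complex_scalars R)) => /(_ e0).
  apply: filterS => s; rewrite map_fB => h.
  by rewrite -ltcR (le_lt_trans (map_f_le _)).
- have [M h] := (bounded_NonposP (complex_scalars R) _).1 bphi.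
  apply/(bounded_NonposP (real_scalars R)); exists M => t.
  by rewrite wE -lecR (le_trans (map_f_le _))// h.
- apply/(unif_NonposP (real_scalars R)) => e e0.
  have [d d0 h] := (unif_NonposP (complex_scalars R) _).1 uphi e e0.
  exists d => // s t st; rewrite !wE map_fB -ltcR.
  by rewrite (le_lt_trans (map_f_le _))// h.
Qed.

End RealPart.

Definition BUC_Re (phi : BUC_C) : BUC_R :=
  MkBUC (is_BUC_map (f := @complex.Re R) (@Re_mul R) (@ler_norm_Re R) phi).
Definition BUC_Im (phi : BUC_C) : BUC_R :=
  MkBUC (is_BUC_map (f := @complex.Im R) (@Im_mul R) (@ler_norm_Im R) phi).

Definition complexify (Lhat : BUC_R -> 'cV[R]_n) (phi : BUC_C) : 'cV[R[i]]_n :=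
  map_mx rc (Lhat (BUC_Re phi)) + 'i%C *: map_mx rc (Lhat (BUC_Im phi)).

Definition exp_fun (lambda : R[i]) (v : 'cV[R[i]]_n) : Nonpos R -> 'cV[R[i]]_n :=
  fun theta => cexp (lambda * rc (\val theta)) *: v.
Lemma is_BUC_exp (lambda : R[i]) (v : 'cV[R[i]]_n) :
  - eta < complex.Re lambda -> exp_fun lambda v \in is_BUC (complex_scalars R) eta.
Proof.
move=> lam; set mu := lambda + rc eta.
have mu0 : 0 < complex.Re mu.
  by rewrite /mu; case: lambda @mu lam => a b /=; rewrite -subr_gt0 opprK.
have t0 (t : Nonpos R) : \val t <= 0 by exact: set_mem (valP t).
have wE t : weighted (complex_scalars R) eta (exp_fun lambda v) t =
    cexp (mu * rc (\val t)) *: v.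
  rewrite /weighted /exp_fun scalerA mulrDl cexpD mulrC; congr (_ * _ *: _).
  by rewrite /cexp/= !(mul0r, mulr0) subr0 addr0 cos0 sin0 mulr1.
have wuni : unif_continuous (weighted (complex_scalars R) eta (exp_fun lambda v)).
  apply/(unif_NonposP (complex_scalars R)) => e e0.
  pose M := (complex.Re mu + `|complex.Im mu|) * 2.
  have M0 : 0 < M by rewrite mulr_gt0// ltr_wpDr.
  pose N := 1 + complex.Re `|v|.
  have N0 : 0 < N by rewrite ltr_wpDr// (re_norm_ge0 (complex_scalars R)).
  exists (e / (M * N)); first by rewrite divr_gt0// mulr_gt0.
  move=> s t st; rewrite !wE -scalerBl normrZ.
  rewrite (le_lt_trans (ler_wpM2r (normr_ge0 _) (cexp_lip mu0 (t0 s) (t0 t))))//.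
  rewrite -[X in _ * X]Re_normK -rmorphM ltcR -/M.
  rewrite (@le_lt_trans _ _ (M * N * `|\val s - \val t|))//.
    rewrite mulrAC ler_wpM2r// ler_wpM2l ?(ltW M0)//.
    by rewrite /N lerDr.
  by rewrite mulrC -ltr_pdivlMr// mulr_gt0.
apply/is_BUCP; split=> //.
- move=> t.
  have eE : exp_fun lambda v = fun s => rc (expR (- (eta * \val s))) *:
      weighted (complex_scalars R) eta (exp_fun lambda v) s.
    by apply/funext => s; rewrite /weighted scalerA -rmorphM -expRD addNr expR0 scale1r.
  rewrite eE; apply: (@cvgZ _ _ _ _ (nbhs_filter t)).
    apply/(@cvgrPdist_lt _ _ _ _ (nbhs_filter t)) => e e0.
    have er := RRe_real (gtr0_real e0).
    have c1 : continuous (fun r : R => expR (- (eta * r))).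
      move=> r; apply: (@continuous_comp _ _ _ (fun r : R => - (eta * r)) expR).
        apply: (@cvgN _ _ _ _ (nbhs_filter r)).
        by apply: (@cvgMl_tmp _ _ _ (nbhs_filter r)); exact: cvg_id.
      exact: continuous_expR.
    have c := @continuous_comp _ _ _ (set_val : Nonpos R -> R) _ t
      (@initial_continuous _ _ _ t) (c1 _).
    move/(@cvgrPdist_lt _ _ _ _ (nbhs_filter t)): c => /(_ (complex.Re e)).
    rewrite -ltcR er => /(_ e0); apply: filterS => s h.
    by rewrite -rmorphB norm_rc -er ltcR.
  apply/(@cvgrPdist_lt _ _ _ _ (nbhs_filter t)) => e e0.
  have er := RRe_real (gtr0_real e0).
  have [|d d0 h] := (unif_NonposP (complex_scalars R) _).1 wuni (complex.Re e).
    by rewrite -ltcR er.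
  have : \forall s \near t, `|\val t - \val s| < d.
    have /(@cvgrPdist_lt _ _ _ _ (nbhs_filter t)) :=
      @initial_continuous _ _ (set_val : Nonpos R -> R) t.
    exact.
  by apply: (@filterS _ _ (nbhs_filter t)) => s /h; rewrite /= er.
- apply/(bounded_NonposP (complex_scalars R)); exists (re (complex_scalars R) `|v|) => t.
  rewrite wE normrZ norm_cexp norm_reK ler_piMl// -(rmorph1 rc) lecR -expR0 ler_expR.
  by rewrite mulrC Re_mul mulr_le0_ge0// ltW.
Qed.

(* The default value 0 is never used when - eta < Re lambda, see [exp_BUCE]. *)
Definition exp_BUC (lambda : R[i]) (v : 'cV[R[i]]_n) : BUC_C :=
  insubd 0 (exp_fun lambda v).

Lemma exp_BUCE (lambda : R[i]) (v : 'cV[R[i]]_n) : - eta < complex.Re lambda ->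
  exp_BUC lambda v = exp_fun lambda v :> (Nonpos R -> 'cV[R[i]]_n).
Proof. by move=> lam; rewrite /exp_BUC /= val_insubd is_BUC_exp. Qed.

Definition Delta (Lhat : BUC_R -> 'cV[R]_n) (lambda : R[i]) : 'M[R[i]]_n :=
  lambda%:M -
  \matrix_(i, j) complexify Lhat (exp_BUC lambda (delta_mx j ord0)) i ord0.

End Complexification.

(* Main.v *)
From HB Require Import structures.
Require Import Defs.
From mathcomp Require Import all_boot all_order all_algebra.
From mathcomp Require Import complex ring lra.
From mathcomp Require Import all_classical all_reals all_analysis.
Import Order.TTheory GRing.Theory Num.Theory.
Import numFieldNormedType.Exports.

Local Open Scope classical_set_scope.
Local Open Scope ring_scope.

Set Implicit Arguments.
Unset Strict Implicit.
Unset Printing Implicit Defensive.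

(** Why the theorem holds.  Let [lambda] satisfy [Re lambda > - eta].  For
    [x = (0, f)], the equation [lambda x - (A + L) x = (alpha, psi)] means
      [f' = lambda f - psi]   and   [f' 0 - L f = alpha].
    The first equation is a linear differential equation; its solutions are
    [f = e^(lambda .) c + w], where [w] is the particular solution with [w 0 = 0]
    given by variation of constants.  Both terms lie in the weighted space because
    [Re lambda + eta > 0], and the norm of [w] is at most
    [|psi| / (Re lambda + eta)].  Substituting into the second equation leaves the
    finite-dimensional system
      [Delta(lambda) c = alpha + psi 0 + L w].

    If [Delta(lambda)] is invertible, this system has a unique solution, bounded by
    the data, so [lambda] is in the resolvent set of [A + L]
    ([Delta_unit_resolvent]).  If [Delta(lambda) c = 0] with [c != 0], then
    [e^(lambda .) c] is an eigenvector; its image is a multiple of itself, so it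
    belongs to the domain of the part of [A + L] ([exp_eigenvector]).  Finally
    eigenvalues of the part are eigenvalues of [A + L], hence in its spectrum
    ([point_spectrum_sub_spectrum]).  The three sets thus contain each other
    cyclically.

    The analysis behind this is concentrated in a mean value inequality on the
    half-line ([half_deriv_mean_value]).  It gives the uniqueness of solutions
    ([ode_unique]), the bound on [w] ([BUC_ode_solution]) and, through a Lipschitz
    estimate, uniform continuity ([is_BUC_half_deriv]).  The integral in the
    variation of constants formula enters only as an antiderivative
    ([half_deriv_antiderivative]): all estimates come from differential
    inequalities. *)

(** * Derivatives of vector-valued functions on the half-line *)

Lemma rc_ge0 (R : realType) (x : R) : (0 <= real_complex R x) = (0 <= x).
Proof. exact: (emb_ge0 (complex_scalars R)). Qed.

Lemma rc_gt0 (R : realType) (x : R) : (0 < real_complex R x) = (0 < x).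
Proof. exact: (emb_gt0 (complex_scalars R)). Qed.

Lemma ball_NonposE (R : realType) (s t : Nonpos R) (d : R) :
  ball t d s = (`|\val s - \val t| < d).
Proof. by rewrite distrC. Qed.

Section HalfLineDerivative.
Context {R : realType} {V : normedModType R[i]}.
Implicit Types (f g : Nonpos R -> V) (s t : Nonpos R).
Local Notation rc := (real_complex R).

(** This is [has_deriv] over the complex numbers, with values in an arbitrary
    normed space: the product rule needs scalar factors such as
    [exp (lambda * theta)] and vector factors at the same time. *)
Definition half_deriv f g := forall t,
  (fun s => rc (\val s - \val t)^-1 *: (f s - f t)) @ t^' --> g t.

(** Clearing the denominator gives a first-order expansion that also makes sense
    at the base point, so it no longer mentions the punctured neighbourhood in
    the subtype and can be compared with derivatives on the whole line. *)
Lemma half_derivP f g : half_deriv f g <->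
  forall t (e : R), 0 < e -> exists2 d : R, 0 < d &
    forall s, `|\val s - \val t| < d ->
      `|f s - f t - rc (\val s - \val t) *: g t| <= rc (e * `|\val s - \val t|).
Proof.
split=> [H t e e0|H t].
  have /(@cvgrPdist_le _ _ _ _ (dnbhs_filter t)) := H t.
  move=> /(_ (rc e)); rewrite rc_gt0 => /(_ e0).
  rewrite /dnbhs /within /= => /nbhs_ballP[d /= d0 dP]; exists d => // s st.
  have [->|neq] := eqVneq s t.
    by rewrite !subrr rmorph0 scale0r subr0 normr0 normr0 mulr0 rmorph0.
  have := dP s; rewrite ball_NonposE => /(_ st neq) h.
  have st0 : \val s - \val t != 0.
    by rewrite subr_eq0; apply: contra_neq neq => /val_inj.
  have -> : f s - f t - rc (\val s - \val t) *: g t =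
     - (rc (\val s - \val t) *: (g t - rc (\val s - \val t)^-1 *: (f s - f t))).
    by rewrite scalerBr scalerA -rmorphM divff// rmorph1 scale1r opprB.
  by rewrite normrN normrZ norm_rc mulrC rmorphM ler_wpM2r// rc_ge0.
apply/(@cvgrPdist_le _ _ _ _ (dnbhs_filter t)) => e e0.
have er := RRe_real (gtr0_real e0).
have [|d d0 dP] := H t (complex.Re e); first by rewrite -ltcR er.
rewrite /dnbhs /within /=; apply/nbhs_ballP; exists d => //= s.
rewrite ball_NonposE => st neq.
have st0 : \val s - \val t != 0.
  by rewrite subr_eq0; apply: contra_neq neq => /val_inj.
have -> : g t - rc (\val s - \val t)^-1 *: (f s - f t) =
     - (rc (\val s - \val t)^-1 *: (f s - f t - rc (\val s - \val t) *: g t)).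
  by rewrite [in RHS]scalerBr scalerA -rmorphM mulVf// rmorph1 scale1r opprB.
rewrite normrN normrZ norm_rc normfV -er.
have : 0 < rc `|\val s - \val t| by rewrite rc_gt0 normr_gt0.
move=> h; rewrite fmorphV ler_pdivrMl// mulrC -rmorphM.
exact: dP.
Qed.

Lemma half_deriv_continuous f g : half_deriv f g -> continuous f.
Proof.
move=> /half_derivP H t; apply/(@cvgrPdist_le _ _ _ _ (nbhs_filter t)) => e e0.
have er := RRe_real (gtr0_real e0).
have e'0 : 0 < complex.Re e by rewrite -ltcR er.
have [d d0 dP] := H t 1 ltr01.
(* With error coefficient 1 in the expansion, [f] is (1 + |g t|)-Lipschitz at [t]. *)
set N := 1 + complex.Re `|g t|.
have N0 : 0 < N by rewrite ltr_wpDr// (re_norm_ge0 (complex_scalars R)).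
apply/nbhs_ballP; exists (Num.min d (complex.Re e / N)) => /=.
  by rewrite lt_min d0 divr_gt0.
move=> s; rewrite ball_NonposE lt_min => /andP[/dP h1 h2].
rewrite distrC -(subrK (rc (\val s - \val t) *: g t) (f s - f t)).
rewrite (le_trans (ler_normD _ _))// (le_trans (lerD h1 (lexx _)))//.
rewrite normrZ norm_rc mul1r -(Re_normK (g t)) -rmorphM -rmorphD -er lecR.
by rewrite -[X in X + _]mulr1 -mulrDr -/N -ler_pdivlMr// ltW.
Qed.

Lemma half_derivD f f' g g' :
  half_deriv f f' -> half_deriv g g' -> half_deriv (f + g) (f' + g').
Proof.
move=> df dg t.
have := @cvgD _ _ _ _ (dnbhs_filter t) _ _ _ _ (df t) (dg t).
apply: cvg_trans; apply: near_eq_cvg; apply: (@filterE _ _ (dnbhs_filter t)) => s.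
by rewrite !fctE -scalerDr opprD addrACA.
Qed.

Lemma half_deriv_cst (v : V) : half_deriv (fun=> v) 0.
Proof.
move=> t; rewrite (_ : (fun s => _) = fun=> 0); last first.
  by apply/funext => s; rewrite subrr scaler0.
exact: (@cvg_cst _ _ _ _ (dnbhs_filter t)).
Qed.

End HalfLineDerivative.

Section HalfLineDerivativeProduct.
Context {R : realType} {V : normedModType R[i]}.
Implicit Types (f g : Nonpos R -> V) (s t : Nonpos R).
Local Notation rc := (real_complex R).

(** The usual splitting [c s f s - c t f t = (c s - c t) f s + c t (f s - f t)];
    the first term uses that differentiable functions are continuous. *)
Lemma half_derivZ (c c' : Nonpos R -> R[i]^o) f f' :
  half_deriv c c' -> half_deriv f f' ->
  half_deriv (fun t => c t *: f t) (fun t => c' t *: f t + c t *: f' t).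
Proof.
move=> dc df t.
have cf : (fun s => f s) @ t^' --> f t.
  have h : f @ nbhs t --> f t := @half_deriv_continuous _ _ _ _ df t.
  exact: (@cvg_within_filter _ _ f _ (nbhs_filter t) _ _ h).
have h1 := @cvgZ _ _ _ _ (dnbhs_filter t) _ _ _ _ (dc t) cf.
have h2 := @cvgZl_tmp _ _ _ _ (dnbhs_filter t) (c t) _ _ (df t).
have := @cvgD _ _ _ _ (dnbhs_filter t) _ _ _ _ h1 h2.
apply: cvg_trans; apply: near_eq_cvg; apply: (@filterE _ _ (dnbhs_filter t)) => s /=.
have -> : c s *: f s - c t *: f t = (c s - c t) *: f s + c t *: (f s - f t).
  by rewrite scalerBl scalerBr subrKA.
set a := rc (\val s - \val t)^-1.
rewrite -[LHS]/((a * (c s - c t)) *: f s + c t *: (a *: (f s - f t))).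
by rewrite [RHS]scalerDr !scalerA [c t * a]mulrC.
Qed.

Lemma half_deriv_sum (I : Type) (r : seq I)
    (f f' : I -> Nonpos R -> V) : (forall i, half_deriv (f i) (f' i)) ->
  half_deriv (\sum_(i <- r) f i) (\sum_(i <- r) f' i).
Proof.
move=> df; elim/big_rec2 : _ => [|i g' g _ dg]; first exact: half_deriv_cst.
exact: half_derivD.
Qed.

Lemma half_deriv_scalel (c c' : Nonpos R -> R[i]^o) (v : V) :
  half_deriv c c' -> half_deriv (fun t => c t *: v) (fun t => c' t *: v).
Proof.
move=> dc; have := half_derivZ dc (half_deriv_cst v).
by congr half_deriv; apply/funext => t; rewrite scaler0 addr0.
Qed.

Lemma half_deriv_scaler (c : R[i]) (f f' : Nonpos R -> V) :
  half_deriv f f' -> half_deriv (fun t => c *: f t) (fun t => c *: f' t).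
Proof.
move=> df; have := half_derivZ (half_deriv_cst (c : R[i]^o)) df.
by congr half_deriv; apply/funext => t; rewrite scale0r add0r.
Qed.

End HalfLineDerivativeProduct.

Section RealDerivatives.
Context {R : realType}.
Local Notation rc := (real_complex R).

(** The counterpart of [half_derivP] on the whole line; the two
    characterizations together transfer derivatives between the line and the
    half-line in both directions. *)
Lemma is_derive_distP (f : R -> R) (x d : R) : is_derive x 1 f d <->
  forall e : R, 0 < e -> exists2 r : R, 0 < r &
    forall y, `|y - x| < r -> `|f y - f x - (y - x) * d| <= e * `|y - x|.
Proof.
split=> [[df fE] e e0|H].
  have := df; rewrite /derivable => /cvg_ex[l hl].
  have ld : l = d by rewrite -fE; apply/esym/cvg_lim.
  move: hl; rewrite {}ld => /cvgrPdist_le /(_ e e0).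
  rewrite /dnbhs /within /= => /nbhs_ballP[r /= r0 rP]; exists r => // y yx.
  have [->|neq] := eqVneq y x; first by rewrite !subrr mul0r subr0 normr0 mulr0.
  have yx0 : y - x != 0 by rewrite subr_eq0.
  have := rP (y - x); rewrite /ball /= sub0r normrN => /(_ yx yx0).
  rewrite [(y - x) *: 1]mulr1 subrK => h.
  have -> : f y - f x - (y - x) * d = - ((y - x) * (d - (y - x)^-1 *: (f y - f x))).
    by rewrite mulrBr -[_ *: _]/(_ * _) mulVKf// opprB.
  by rewrite normrN normrM mulrC ler_wpM2r.
have h : (fun h : R => h^-1 *: (f (h *: 1 + x) - f x)) @ 0^' --> d.
  apply/cvgrPdist_le => e e0; have [r r0 rP] := H e e0.
  rewrite /dnbhs /within /=; apply/nbhs_ballP; exists r => //= y.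
  rewrite /ball /= sub0r normrN => yr y0.
  have := rP (y + x); rewrite addrK => /(_ yr) h.
  rewrite [y *: 1]mulr1.
  have -> : d - y^-1 *: (f (y + x) - f x) = - (y^-1 * (f (y + x) - f x - y * d)).
    by rewrite -[_ *: _]/(_ * _) [in RHS]mulrBr mulKf// opprB.
  by rewrite normrN normrM normfV ler_pdivrMl ?normr_gt0// [leRHS]mulrC.
have df : derivable f x 1 by apply/cvg_ex; exists d; exact: h.
by split=> //; apply/cvg_lim => //; exact: h.
Qed.

Lemma half_deriv_real (f df : R -> R) :
  (forall x : R, x <= 0 -> is_derive x 1 f (df x)) ->
  half_deriv (fun t : Nonpos R => rc (f (\val t)) : R[i]^o)
    (fun t => rc (df (\val t))).
Proof.
move=> H; apply/half_derivP => t e e0.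
have /is_derive_distP/(_ _ e0)[r r0 rP] := H _ (set_mem (valP t)).
exists r => // s st.
by rewrite -[_ *: _]/(_ * _) -rmorphM -!rmorphB norm_rc lecR rP.
Qed.

Lemma half_deriv_cexp (lambda : R[i]) :
  half_deriv (fun t : Nonpos R => cexp (lambda * rc (\val t)) : R[i]^o)
    (fun t => lambda * cexp (lambda * rc (\val t))).
Proof.
case: lambda => a b.
have cE r : cexp ((a +i* b)%C * rc r) =
    rc (expR (a * r) * cos (b * r)) + 'i%C * rc (expR (a * r) * sin (b * r)).
  rewrite /cexp/= !mulr0 subr0 add0r [X in _ * X]complexE /= mulrDr.
  by rewrite rmorphM [in RHS]rmorphM [in RHS]mulrCA.
have d1 (x : R) : is_derive x 1 (fun x => expR (a * x) * cos (b * x))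
   (a * (expR (a * x) * cos (b * x)) - b * (expR (a * x) * sin (b * x))).
  by apply: is_derive_eq; rewrite /GRing.scale /=; ring.
have d2 (x : R) : is_derive x 1 (fun x => expR (a * x) * sin (b * x))
   (a * (expR (a * x) * sin (b * x)) + b * (expR (a * x) * cos (b * x))).
  by apply: is_derive_eq; rewrite /GRing.scale /=; ring.
have := half_derivD (half_deriv_real (fun x _ => d1 x))
  (half_derivZ (half_deriv_cst ('i%C : R[i]^o)) (half_deriv_real (fun x _ => d2 x))).
congr (half_deriv _ _); apply/funext => t; rewrite cE//.
rewrite !fctE scale0r add0r -[_ *: _]/(_ * _).
set u := expR _ * cos _; set v := expR _ * sin _.
apply/eqP; rewrite eq_complex /=; apply/andP; split; apply/eqP; ring.
Qed.

End RealDerivatives.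

(** * The mean value inequality *)

Section MeanValueInequality.
Context {R : realType}.
Local Notation rc := (real_complex R).

Fact clamp_subproof (x : R) : Num.min x 0 \in [set x : R | x <= 0].
Proof. by apply/mem_set; rewrite /= ge_min lexx orbT. Qed.

(** Composing with this retraction of the line onto the half-line extends a
    function by the constant [f 0]; the extension is continuous, and it has the
    same derivative at negative points, which is all that the mean value theorem
    asks for. *)
Definition clamp (x : R) : Nonpos R := exist _ (Num.min x 0) (clamp_subproof x).

Lemma clampE (x : R) : x <= 0 -> \val (clamp x) = x.
Proof. exact: min_idPl. Qed.

Lemma clampK (t : Nonpos R) : clamp (\val t) = t.
Proof. by apply/val_inj; rewrite clampE//; exact: set_mem (valP t). Qed.

Lemma clamp_dist (x y : R) : `|\val (clamp x) - \val (clamp y)| <= `|x - y|.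
Proof.
wlog xy : x y / x <= y => [h|].
  have /orP[xy|yx] := le_total x y; first exact: h.
  by rewrite distrC [leRHS]distrC; exact: h.
have h : Num.min x 0 <= Num.min y 0 by rewrite le_min !ge_min xy lexx orbT.
rewrite distrC [leRHS]distrC !ger0_norm ?subr_ge0//=.
by rewrite /Num.min; case: ifPn; case: ifPn; lra.
Qed.

Lemma continuous_clamp : continuous clamp.
Proof.
move=> x A /nbhs_ballP[d /= d0 dA]; apply/nbhs_ballP; exists d => //= y xy.
apply: dA; rewrite ball_NonposE (le_lt_trans (clamp_dist _ _))//.
by rewrite distrC.
Qed.

Lemma continuous_functional (V : normedModType R[i]) (l : {additive V -> R})
    (g : Nonpos R -> V) : (forall v, `|l v| <= complex.Re `|v|) ->
  continuous g -> continuous (fun x => l (g (clamp x))).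
Proof.
move=> l_le cg x; apply/cvgrPdist_lt => e e0.
have /(@cvgrPdist_lt _ _ _ _ (nbhs_filter (clamp x))) := cg (clamp x).
move=> /(_ (rc e)); rewrite rc_gt0 => /(_ e0) H.
have := continuous_clamp (x:=x) H.
apply: (@filterS _ _ (nbhs_filter x)) => y /= h.
by rewrite -raddfB (le_lt_trans (l_le _))// -ltcR Re_normK.
Qed.

Section Functional.
Context {V : normedModType R[i]} (l : {additive V -> R}).
Hypothesis lZ : forall (a : R) v, l (rc a *: v) = a * l v.
Hypothesis l_le : forall v, `|l v| <= complex.Re `|v|.
Variables f g : Nonpos R -> V.
Hypothesis fg : half_deriv f g.

Let F x := l (f (clamp x)).

Let F_continuous : continuous F.
Proof. exact: (@continuous_functional V l f l_le (half_deriv_continuous fg)). Qed.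

Let F_derive (x : R) : x < 0 -> is_derive x 1 F (l (g (clamp x))).
Proof.
move=> x0; apply/is_derive_distP => e e0.
have [r r0 rP] := (half_derivP _ _).1 fg (clamp x) e e0.
exists (Num.min r (- x)) => [|y]; first by rewrite lt_min r0 oppr_gt0.
rewrite lt_min => /andP[yr yx].
have y0 : y <= 0 by move: yx; rewrite ltr_norml => /andP[_]; lra.
have := rP (clamp y); rewrite !clampE ?(ltW x0)// => /(_ yr) h.
rewrite /F -lZ -!raddfB (le_trans (l_le _))// -lecR Re_normK.
exact: h.
Qed.

(** [h - F] has the nonnegative derivative [dh - l g], so it is nondecreasing. *)
Lemma functional_mean_value (h dh : R -> R) :
  (forall x : R, is_derive x 1 h (dh x)) ->
  (forall t, `|g t| <= rc (dh (\val t))) ->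
  forall s t, \val s <= \val t -> l (f t - f s) <= h (\val t) - h (\val s).
Proof.
move=> dhE gh s t st.
have t0 : \val t <= 0 by exact: set_mem (valP t).
have [x|| c] :=
  @MVT_segment R (h - F) (fun x => dh x - l (g (clamp x))) _ _ st.
- rewrite in_itv /= => /andP[sx xt].
  have x0 : x < 0 by exact: lt_le_trans t0.
  have := F_derive x0; have := dhE x => ? ?.
  exact: is_deriveB.
- apply: continuous_subspaceT => x; apply: cvgB; last exact: F_continuous.
  by apply/differentiable_continuous/derivable1_diffP; have [] := dhE x.
rewrite in_itv /= => /andP[sc ct]; rewrite !fctE /F !clampK => hE.
suff : 0 <= h (\val t) - l (f t) - (h (\val s) - l (f s)).
  by rewrite [l (_ - _)]raddfB => ?; lra.
rewrite hE mulr_ge0 ?subr_ge0//.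
rewrite (le_trans (ler_norm _))// (le_trans (l_le _))// -lecR Re_normK.
by have := gh (clamp c); rewrite clampE// (le_trans ct).
Qed.

End Functional.

(** The mean value theorem fails for vector values, but it applies to every
    functional [w |-> Re (c * w_i)] with [|c| = 1].  Choosing [i] such that the
    sup norm of [v = f t - f s] is [|v_i|], and [c] such that [c * v_i = |v_i|],
    loses nothing. *)
Lemma half_deriv_mean_value n (f g : Nonpos R -> 'cV[R[i]]_n) (h dh : R -> R) :
  half_deriv f g -> (forall x : R, is_derive x 1 h (dh x)) ->
  (forall t, `|g t| <= rc (dh (\val t))) ->
  forall s t, \val s <= \val t -> `|f t - f s| <= rc (h (\val t) - h (\val s)).
Proof.
move=> fg dhE gh s t st; set v := f t - f s.
have entry_le i (c : R[i]) : `|c| = 1 ->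
    complex.Re (c * v i 0) <= h (\val t) - h (\val s).
  move=> c1.
  pose l0 (w : 'cV[R[i]]_n) := complex.Re (c * w i 0).
  have lD : {morph l0 : x y / x - y} by move=> x y; rewrite /l0 !mxE mulrBr raddfB.
  pose l : {additive 'cV[R[i]]_n -> R} :=
    HB.pack l0 (GRing.isZmodMorphism.Build _ _ l0 lD).
  apply: (@functional_mean_value _ l _ _ _ _ fg _ _ dhE gh s t st).
    by move=> a w; rewrite /l /= /l0 mxE mulrCA Re_mul.
  move=> w; rewrite /l /= /l0 (le_trans (ler_norm_Re _))// -lecR !Re_normK.
  by rewrite normrM c1 mul1r ler_coef_mx_norm.
(* The zero functional shows that [h] is nondecreasing, which settles [v = 0]. *)
have hst : 0 <= rc (h (\val t) - h (\val s)).
  rewrite rc_ge0.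
  pose l : {additive 'cV[R[i]]_n -> R} := \0.
  apply: (@functional_mean_value _ l _ _ _ _ fg _ _ dhE gh s t st) => [a w|w] /=.
    by rewrite mulr0.
  by rewrite normr0 (re_norm_ge0 (complex_scalars R)).
have [->//|/mx_norm_neq0[[i j] /= vE]] := eqVneq `|v| 0.
have -> : `|v| = `|v i j| := vE.
rewrite (ord1 j); set z := v i 0; have [->|z0] := eqVneq z 0; first by rewrite normr0.
have zn0 : `|z| != 0 by rewrite normr_eq0.
have := entry_le i (z^* / `|z|); rewrite normrM norm_conjC normfV normr_id divff// -/z.
have -> : z^* / `|z| * z = `|z| by rewrite mulrAC [_ * z]mulrC -normCK expr2 mulfK.
by move=> /(_ erefl); rewrite -lecR Re_normK.
Qed.

End MeanValueInequality.

(** * Antiderivatives *)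

Section Antiderivative.
Context {R : realType}.
Local Notation rc := (real_complex R).

(** The fundamental theorem of calculus differentiates an integral with respect
    to its upper bound, on the right of a fixed lower bound.  The half-line has no
    lower bound, so it is reflected: the integral of [g (- t)] from -1 to [- x] is
    differentiable for every [x <= 0], as -1 lies strictly below [- x]. *)
Lemma real_antiderivative (g : R -> R) : continuous g ->
  exists F : R -> R, forall x : R, x <= 0 -> is_derive x 1 F (g x).
Proof.
move=> cg.
have cf : continuous (fun y => g (- y)).
  move=> x; apply: continuous_comp; last exact: cg.
  exact: opp_continuous.
pose I y := (\int[lebesgue_measure]_(t in `[-1, y]) g (- t))%R.
exists (- (fun x => I (- x))) => x x0.
have ox : -1 < - x by lra.
have int : lebesgue_measure.-integrable `[-1, - x + 1] (EFin \o (fun y => g (- y))).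
  apply: continuous_compact_integrable; first exact: segment_compact.
  exact: continuous_subspaceT.
have xu : - x < - x + 1 by rewrite ltrDl.
have [dI IE] := continuous_FTC1_closed xu int ox (cf (- x)).
have dI' : is_derive (- x) 1 I (g x).
  by split; [exact: dI|rewrite -derive1E IE opprK].
have dN : is_derive x 1 (-%R : R -> R) (- 1).
  exact: is_deriveNid.
have := is_deriveN (is_derive1_comp dI' dN).
by rewrite mulrN1 opprK.
Qed.

(** Integrates the real and imaginary parts of the coordinates separately. *)
Lemma half_deriv_antiderivative n (g : Nonpos R -> ('cV[R[i]]_n : normedModType R[i])) :
  continuous g -> exists G, half_deriv G g.
Proof.
move=> cg.
have comp (p : {additive R[i] -> R}) i : (forall z, `|p z| <= complex.Re `|z|) ->
    exists F : R -> R, forall x : R, x <= 0 -> is_derive x 1 F (p (g (clamp x) i 0)).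
  move=> p_le; apply: real_antiderivative.
  pose l0 (w : 'cV[R[i]]_n) := p (w i 0).
  have lD : {morph l0 : x y / x - y} by move=> x y; rewrite /l0 !mxE raddfB.
  pose l : {additive 'cV[R[i]]_n -> R} :=
    HB.pack l0 (GRing.isZmodMorphism.Build _ _ l0 lD).
  apply: (@continuous_functional R _ l) => // w.
  by rewrite /l /= /l0 (le_trans (p_le _))// -lecR !Re_normK ler_coef_mx_norm.
have /choice[F FE] i := comp (@complex.Re R) i (@ler_norm_Re R).
have /choice[H HE] i := comp (@complex.Im R) i (@ler_norm_Im R).
exists (\sum_i (fun t => (rc (F i (\val t)) + 'i%C * rc (H i (\val t))) *: delta_mx i 0)).
have -> : g = \sum_i (fun t =>
    (rc (complex.Re (g t i 0)) + 'i%C * rc (complex.Im (g t i 0))) *: delta_mx i 0).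
  apply/funext => t; rewrite fct_sumE [LHS]matrix_sum_delta.
  by apply: eq_bigr => i _; rewrite big_ord1 -complexE.
apply: half_deriv_sum => i; apply: half_deriv_scalel.
have dF := half_deriv_real (FE i); have dH := half_deriv_real (HE i).
have := half_derivD dF (@half_deriv_scaler R _ 'i%C _ _ dH).
by congr half_deriv; apply/funext => t; rewrite !fctE !clampK.
Qed.

End Antiderivative.

(** * The equation [w' = lambda w - psi] in the weighted space *)

Section BUCNormBounds.
Context {R : realType} {K : numFieldType} (k : scalars R K).
Context {n : nat} {eta : R}.
Implicit Types phi : BUC k n eta.

Lemma BUC_norm_ge phi t : emb k (expR (eta * \val t)) * `|phi t| <= `|phi|.
Proof.
rewrite -[X in _ * X](norm_reK k) -rmorphM ler_emb; apply: ub_le_sup; last by exists t.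
have /is_BUCP[_ /(bounded_NonposP k)[M phiM] _] := valP phi.
exists M => _ [s _ <-]; rewrite -(ler_emb k) rmorphM norm_reK.
by have := phiM s; rewrite normrZ norm_emb ger0_norm ?expR_ge0.
Qed.

Lemma BUC_norm_le phi (M : R) :
  (forall t, emb k (expR (eta * \val t)) * `|phi t| <= emb k M) -> `|phi| <= emb k M.
Proof.
move=> h; rewrite ler_emb; apply: ge_sup.
  by eexists; exists (nonpos0 R).
by move=> _ [t _ <-]; rewrite -(ler_emb k) rmorphM norm_reK.
Qed.

End BUCNormBounds.

Section VariationOfConstants.
Context {R : realType} {n : nat} {eta : R}.
Local Notation rc := (real_complex R).
Local Notation BUC_C := (BUC (complex_scalars R) n eta).

Lemma cexp_rc (a : R) : cexp (rc a) = rc (expR a).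
Proof. by rewrite /cexp /= cos0 sin0 mulr1. Qed.

Lemma cexpN (z : R[i]) : cexp z * cexp (- z) = 1.
Proof. by rewrite -cexpD subrr -(rmorph0 rc) cexp_rc expR0 rmorph1. Qed.

Lemma norm_cexpM (lambda : R[i]) (x : R) :
  `|cexp (lambda * rc x)| = rc (expR (complex.Re lambda * x)).
Proof. by rewrite norm_cexp mulrC Re_mul mulrC. Qed.

(** If [f] and [f'] have bounded weighted norms, then so has the derivative
    [eta e^(eta t) f + e^(eta t) f'] of the weighted function, which is therefore
    Lipschitz, hence uniformly continuous. *)
Lemma is_BUC_half_deriv (f g : Nonpos R -> 'cV[R[i]]_n) (M N : R) :
  half_deriv f g ->
  (forall t, `|weighted (complex_scalars R) eta f t| <= rc M) ->
  (forall t, `|weighted (complex_scalars R) eta g t| <= rc N) ->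
  f \in is_BUC (complex_scalars R) eta.
Proof.
move=> fg fM gN; apply/is_BUCP; split.
- exact: half_deriv_continuous fg.
- by apply/(bounded_NonposP (complex_scalars R)); exists M.
- apply/(unif_NonposP (complex_scalars R)) => e e0.
  pose C := `|eta| * M + N.
  have M0 : 0 <= M by rewrite -lecR (le_trans _ (fM (nonpos0 R))).
  have N0 : 0 <= N by rewrite -lecR (le_trans _ (gN (nonpos0 R))).
  have C0 : 0 < 1 + C by rewrite ltr_wpDr// addr_ge0// mulr_ge0.
  have wE f0 t : weighted (complex_scalars R) eta f0 t =
      cexp (rc eta * rc (\val t)) *: f0 t.
    by rewrite -rmorphM cexp_rc.
  have lip s t : \val s <= \val t ->
      `|weighted (complex_scalars R) eta f t - weighted (complex_scalars R) eta f s|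
        <= rc (C * (\val t - \val s)).
    move=> st; have dwf := half_derivZ (@half_deriv_cexp R (rc eta)) fg.
    have dh (x : R) : is_derive x 1 (fun x => C * x) C.
      by apply: is_derive_eq; rewrite /GRing.scale /= mulr1.
    have := half_deriv_mean_value dwf dh _ st; rewrite mulrBr !wE; apply=> r.
    rewrite -scalerA -!wE (le_trans (ler_normD _ _))// rmorphD lerD//.
    by rewrite normrZ norm_rc rmorphM ler_wpM2l// rc_ge0.
  exists (e / (1 + C)); first by rewrite divr_gt0.
  have main s t : \val s <= \val t -> `|\val t - \val s| < e / (1 + C) ->
      `|weighted (complex_scalars R) eta f t - weighted (complex_scalars R) eta f s|
        < rc e.
    move=> st; rewrite ger0_norm ?subr_ge0// ltr_pdivlMr// => h.
    rewrite (le_lt_trans (lip _ _ st))// ltcR (le_lt_trans _ h)//.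
    by rewrite mulrC ler_wpM2l ?subr_ge0// lerDr.
  move=> s t; have /orP[st|ts] := le_total (\val s) (\val t); last exact: main.
  by rewrite distrC [X in _ -> X < _]distrC; exact: main.
Qed.

(** The variation of constants formula
    [w t = - e^(lambda t) * \int_0^t e^(- lambda s) psi s ds].  With
    [a = Re lambda + eta > 0], the integrand is bounded by [|psi| e^(- a s)]; the
    mean value inequality bounds the integral by [|psi| / a * e^(- a t)], and the
    factor [e^((Re lambda + eta) t)] of the weighted solution cancels this growth.
    The equation itself then bounds the weighted norm of [w']. *)
Lemma BUC_ode_solution (lambda : R[i]) (psi : BUC_C) : - eta < complex.Re lambda ->
  exists w : BUC_C, [/\ w (nonpos0 R) = 0,
      has_deriv (complex_scalars R) w (lambda *: w - psi)
    & `|w| <= rc (complex.Re lambda + eta)^-1 * `|psi|].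
Proof.
move=> lam; set a := complex.Re lambda + eta.
have a0 : 0 < a by rewrite /a -ltrBlDr sub0r.
have t_le0 (t : Nonpos R) : \val t <= 0 by exact: set_mem (valP t).
have /is_BUCP[cpsi _ _] := valP psi.
pose E (mu : R[i]) (t : Nonpos R) : R[i]^o := cexp (mu * rc (\val t)).
have dE mu : half_deriv (E mu) (fun t => mu * E mu t) := @half_deriv_cexp R mu.
have EN t : E lambda t * E (- lambda) t = 1 by rewrite /E mulNr cexpN.
have [|G dG] := @half_deriv_antiderivative R n (fun t => E (- lambda) t *: psi t).
  move=> t; apply: (@cvgZ _ _ _ _ (nbhs_filter t)); last exact: cpsi.
  exact: (half_deriv_continuous (dE (- lambda))).
pose P := complex.Re `|psi|.
have P0 : 0 <= P by rewrite /P -lecR Re_normK normr_ge0.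
have PE : rc P = `|psi| by rewrite /P Re_normK.
have G_le t : `|G (nonpos0 R) - G t| <= rc (P / a * expR (- a * \val t)).
  have dh (x : R) : is_derive x 1 (fun x => - (P / a) * expR (- a * x))
      (P * expR (- a * x)).
    apply: is_derive_eq; rewrite /GRing.scale /=; field.
    by rewrite gt_eqF.
  have dG_le s : `|E (- lambda) s *: psi s| <= rc (P * expR (- a * \val s)).
    rewrite normrZ norm_cexpM raddfN /=.
    have -> : expR (- complex.Re lambda * \val s) =
        expR (- a * \val s) * expR (eta * \val s).
      by rewrite -expRD; congr expR; rewrite /a; ring.
    rewrite [rc (P * _)]rmorphM /= PE [leRHS]mulrC [rc (_ * _)]rmorphM -mulrA.
    rewrite ler_wpM2l ?rc_ge0 ?expR_ge0//.
    exact: (BUC_norm_ge psi s).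
  have := @half_deriv_mean_value _ _ _ _ _ _ dG dh dG_le t (nonpos0 R) (t_le0 t).
  rewrite /= mulr0 expR0 mulr1 => h; apply: le_trans h _.
  by rewrite lecR mulNr opprK gerDr oppr_le0 divr_ge0// ltW.
pose N := complex.Re `|lambda|.
have NE : rc N = `|lambda| by rewrite /N Re_normK.
pose w t := - (E lambda t *: (G t - G (nonpos0 R))).
have w_le t : rc (expR (eta * \val t)) * `|w t| <= rc (P / a).
  rewrite /w normrN normrZ norm_cexpM distrC mulrA -rmorphM -expRD -mulrDl.
  rewrite (le_trans (ler_wpM2l _ (G_le t))) ?rc_ge0 ?expR_ge0//.
  rewrite -rmorphM mulrCA -expRD -mulrDl [eta + _]addrC -/a subrr mul0r expR0.
  by rewrite mulr1.
have dw : half_deriv w (lambda *: w - (psi : _ -> _)).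
  have := @half_deriv_scaler R _ (-1) _ _
    (half_derivZ (dE lambda) (half_derivD dG (half_deriv_cst (- G (nonpos0 R))))).
  congr half_deriv; apply/funext => t; rewrite /w !fctE ?scaleN1r//.
  rewrite addr0 opprD [E lambda t *: (E _ _ *: _)]scalerA EN scale1r.
  by rewrite scalerN scalerA.
have w_BUC : w \in is_BUC (complex_scalars R) eta.
  apply: (is_BUC_half_deriv (M := P / a) (N := N * (P / a) + P) dw) => t.
    by rewrite normrZ norm_rc ger0_norm ?expR_ge0//; exact: w_le.
  rewrite normrZ norm_rc ger0_norm ?expR_ge0// !fctE.
  rewrite (le_trans (ler_wpM2l _ (ler_normB _ _))) ?rc_ge0 ?expR_ge0//.
  rewrite mulrDr rmorphD /= PE lerD //; last exact: (BUC_norm_ge psi t).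
  by rewrite normrZ mulrCA rmorphM /= NE ler_wpM2l//; exact: w_le.
exists (MkBUC w_BUC); split.
- by rewrite /= /w subrr scaler0 oppr0.
- exact: dw.
- rewrite -PE -rmorphM mulrC; apply: BUC_norm_le => t; exact: w_le.
Qed.

(** If [f' = lambda f], then [e^(- lambda t) f t] has derivative 0, so it is
    constant. *)
Lemma ode_unique (lambda : R[i]) (f : Nonpos R -> 'cV[R[i]]_n) :
  half_deriv f (lambda *: f) -> f = exp_fun lambda (f (nonpos0 R)).
Proof.
move=> df; have := half_derivZ (@half_deriv_cexp R (- lambda)) df.
rewrite (_ : (fun t => _ + _) = fun=> 0); last first.
  apply/funext => t; rewrite !fctE [X in _ + X]scalerA [_ * lambda]mulrC -scalerDl.
  by rewrite mulNr addNr scale0r.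
move=> d0; apply/funext => t; rewrite /exp_fun.
have t0 : \val t <= 0 by exact: set_mem (valP t).
have d00 (x : R) : is_derive x 1 (fun=> 0 : R) 0 by exact: is_derive_cst.
have le00 (s : Nonpos R) : `|0 : 'cV[R[i]]_n| <= rc 0 by rewrite normr0.
have := @half_deriv_mean_value _ _ _ _ _ _ d0 d00 le00 t (nonpos0 R) t0.
rewrite subr0 normr_le0 subr_eq0 mulr0 -(rmorph0 rc) cexp_rc expR0 rmorph1 scale1r.
by move=> /eqP->; rewrite scalerA mulNr cexpN scale1r.
Qed.

End VariationOfConstants.

(** * The complexified functional and the exponentials *)

Section MatrixNorm.
Context {K : numFieldType}.

Lemma mx_norm_le m n (v : 'M[K]_(m, n)) (M : K) : 0 <= M ->
  (forall i j, `|v i j| <= M) -> `|v| <= M.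
Proof.
move=> M0 h; have [->//|/mx_norm_neq0[[i j] /= vE]] := eqVneq `|v| 0.
by have -> : `|v| = `|v i j| := vE.
Qed.

Lemma mulmx_bounded m n p (A : 'M[K]_(m, n)) :
  exists2 C : K, 0 <= C & forall v : 'M[K]_(n, p), `|A *m v| <= C * `|v|.
Proof.
have S0 (P : pred 'I_m) (f : 'I_m -> 'I_n -> K) :
    0 <= \sum_(i | P i) \sum_j `|f i j|.
  by apply: sumr_ge0 => i _; apply: sumr_ge0.
exists (\sum_i \sum_j `|A i j|) => [|v]; first exact: S0.
apply: mx_norm_le => [|i l]; first by rewrite mulr_ge0// S0.
rewrite mxE (le_trans (ler_norm_sum _ _ _))//.
rewrite (bigD1 i)//= mulrDl -[leLHS]addr0 lerD ?mulr_ge0 ?S0// mulr_suml.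
by apply: ler_sum => j _; rewrite normrM ler_wpM2l// ler_coef_mx_norm.
Qed.

End MatrixNorm.

Section ComplexifiedOperator.
Context {R : realType} {n : nat} {eta : R}.
Local Notation rc := (real_complex R).
Local Notation BUC_R := (BUC (real_scalars R) n eta).
Local Notation BUC_C := (BUC (complex_scalars R) n eta).
Variable Lhat : {linear BUC_R -> 'cV[R]_n}.

Lemma complexify_linear (a : R[i]) (phi psi : BUC_C) :
  complexify Lhat (a *: phi + psi) = a *: complexify Lhat phi + complexify Lhat psi.
Proof.
case: a => x y.
have ReE : BUC_Re ((x +i* y)%C *: phi + psi) =
    x *: BUC_Re phi - y *: BUC_Im phi + BUC_Re psi.
  apply/val_inj/funext => t; apply/matrixP => i j.
  rewrite -[LHS]/(map_mx (@complex.Re R) ((x +i* y)%C *: phi t + psi t) i j).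
  rewrite -[RHS]/((x *: BUC_Re phi t - y *: BUC_Im phi t + BUC_Re psi t) i j) !mxE.
  by case: (phi t i j) (psi t i j) => ? ? [].
have ImE : BUC_Im ((x +i* y)%C *: phi + psi) =
    x *: BUC_Im phi + y *: BUC_Re phi + BUC_Im psi.
  apply/val_inj/funext => t; apply/matrixP => i j.
  rewrite -[LHS]/(map_mx (@complex.Im R) ((x +i* y)%C *: phi t + psi t) i j).
  rewrite -[RHS]/((x *: BUC_Im phi t + y *: BUC_Re phi t + BUC_Im psi t) i j) !mxE.
  by case: (phi t i j) (psi t i j) => ? ? [].
rewrite /complexify ReE ImE !(linearD, linearN, linearZ) /=.
apply/matrixP => i j; rewrite !mxE.
apply/eqP; rewrite eq_complex /=; apply/andP; split; apply/eqP; ring.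
Qed.

Let norm_part (p : {additive R[i] -> R}) (phi : BUC_C) (psi : BUC_R) :
  (forall z, `|p z| <= complex.Re `|z|) -> (forall t, psi t = map_mx p (phi t)) ->
  rc `|psi| <= `|phi|.
Proof.
move=> p_le E; rewrite -[leRHS]Re_normK lecR.
apply: (@BUC_norm_le _ _ (real_scalars R)) => t.
rewrite -[leLHS]/(expR (eta * \val t) * `|psi t|) -[leRHS]/(complex.Re `|phi|).
rewrite -lecR Re_normK (le_trans _ (BUC_norm_ge phi t))// rmorphM ler_wpM2l//.
  by rewrite rc_ge0 expR_ge0.
rewrite -Re_normK lecR; apply: mx_norm_le => [|i j].
  by rewrite -lecR Re_normK normr_ge0.
rewrite E mxE (le_trans (p_le _))// -lecR !Re_normK; exact: ler_coef_mx_norm.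
Qed.

(** The real and imaginary parts of a function have at most its norm, so twice a
    bound for the real operator bounds its complexification. *)
Lemma complexify_bounded : bounded_operator Lhat ->
  exists2 M : R[i], 0 <= M & forall phi, `|complexify Lhat phi| <= M * `|phi|.
Proof.
move=> [M HM]; exists (rc (`|M| + `|M|)) => [|phi].
  by rewrite rc_ge0 addr_ge0.
have part_le (p : {additive R[i] -> R}) (psi : BUC_R) :
    (forall z, `|p z| <= complex.Re `|z|) -> (forall t, psi t = map_mx p (phi t)) ->
    `|map_mx rc (Lhat psi)| <= rc `|M| * `|phi|.
  move=> p_le E; apply: mx_norm_le => [|i j].
    by rewrite mulr_ge0// rc_ge0.
  rewrite mxE norm_rc (@le_trans _ _ (rc (`|M| * `|psi|)))//.
    rewrite lecR (le_trans (ler_coef_mx_norm _ _ _))// (le_trans (HM _))//.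
    by rewrite ler_wpM2r// ler_norm.
  by rewrite rmorphM ler_wpM2l ?rc_ge0// (norm_part p_le).
rewrite /complexify (le_trans (ler_normD _ _))// rmorphD mulrDl lerD//.
  exact: (part_le (@complex.Re R) _ (@ler_norm_Re R)).
rewrite normrZ [`|'i%C|]normc_def/= expr0n/= expr1n add0r sqrtr1 mul1r.
exact: (part_le (@complex.Im R) _ (@ler_norm_Im R)).
Qed.

Variables (lambda : R[i]) (lam : - eta < complex.Re lambda).

Lemma exp_BUC_linear (a : R[i]) (u v : 'cV[R[i]]_n) :
  exp_BUC eta lambda (a *: u + v) = a *: exp_BUC eta lambda u + exp_BUC eta lambda v.
Proof.
apply/val_inj; rewrite [LHS](exp_BUCE _ lam).
apply/funext => t.
rewrite -[RHS]/(a *: (exp_BUC eta lambda u) t + (exp_BUC eta lambda v) t).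
rewrite !(exp_BUCE _ lam).
by rewrite /exp_fun scalerDr !scalerA mulrC.
Qed.

Lemma exp_BUC_at0 (v : 'cV[R[i]]_n) : exp_BUC eta lambda v (nonpos0 R) = v.
Proof.
by rewrite exp_BUCE// /exp_fun /= mulr0 -(rmorph0 rc) cexp_rc expR0 rmorph1 scale1r.
Qed.

Lemma exp_BUC_deriv (v : 'cV[R[i]]_n) :
  half_deriv (exp_BUC eta lambda v) (lambda *: exp_BUC eta lambda v).
Proof.
have := @half_deriv_scalel R _ _ _ v (@half_deriv_cexp R lambda).
congr half_deriv; apply/funext => t.
  by rewrite exp_BUCE.
by rewrite -[RHS]/(lambda *: exp_BUC eta lambda v t) exp_BUCE// /exp_fun scalerA.
Qed.

(** [e^(eta t) * |e^(lambda t)| <= 1] on the half-line, as [Re lambda + eta > 0]. *)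
Lemma exp_BUC_norm (v : 'cV[R[i]]_n) : `|exp_BUC eta lambda v| <= `|v|.
Proof.
rewrite -[leRHS]Re_normK; apply: (@BUC_norm_le _ _ (complex_scalars R)) => t.
rewrite -[leRHS]/(rc (complex.Re `|v|)) -[emb _ _]/(rc _) Re_normK exp_BUCE//.
rewrite /exp_fun normrZ norm_cexpM mulrA -rmorphM -expRD -mulrDl.
rewrite ler_piMl// -(rmorph1 rc) lecR -expR0 ler_expR mulr_ge0_le0//.
  by rewrite -lerBlDl sub0r ltW.
exact: set_mem (valP t).
Qed.

(** The matrix in [Delta] lists the values of [v |-> L (e^(lambda .) v)] on the
    standard basis, and this map is linear. *)
Lemma Delta_mul (v : 'cV[R[i]]_n) :
  Delta Lhat lambda *m v = lambda *: v - complexify Lhat (exp_BUC eta lambda v).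
Proof.
rewrite /Delta mulmxBl mul_scalar_mx; congr (_ - _).
pose f0 (u : 'cV[R[i]]_n) := complexify Lhat (exp_BUC eta lambda u).
have f0D : linear f0 by move=> a u w; rewrite /f0 exp_BUC_linear complexify_linear.
pose f : {linear 'cV[R[i]]_n -> 'cV[R[i]]_n} :=
  HB.pack f0 (GRing.isLinear.Build _ _ _ _ f0 f0D).
rewrite -[RHS]/(f v) [v in RHS]matrix_sum_delta linear_sum.
apply/matrixP => i j; rewrite mxE summxE; apply: eq_bigr => l _.
by rewrite big_ord1 linearZ !mxE (ord1 j) mulrC.
Qed.

End ComplexifiedOperator.

(** * Resolvents from bounded solvability *)

Section AbstractSpectrum.
Context {K : numFieldType} {X : normedModType K}.
Implicit Type T : operator X.

Lemma point_spectrum_sub_spectrum T : point_spectrum T `<=` spectrum T.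
Proof.
move=> lambda [x [Tx x0 xE]] [S [_ _ /(_ _ Tx)]].
by rewrite xE subrr linear0 => /esym/eqP; apply/negP.
Qed.

(** Solutions may be chosen without any structure: uniqueness makes the choice
    linear, so the resolvent operator need not be given by a formula. *)
Lemma resolvent_set_bounded_solution T (lambda M : K) :
  (forall a x y, dom T x -> dom T y ->
     dom T (a *: x + y) /\ T (a *: x + y) = a *: T x + T y) ->
  (forall x, dom T x -> T x = lambda *: x -> x = 0) ->
  (forall y, exists x, [/\ dom T x, lambda *: x - T x = y & `|x| <= M * `|y|]) ->
  resolvent_set T lambda.
Proof.
move=> Tlin Tinj /choice[S0 S0P].
have uniq x y : dom T x -> dom T y -> lambda *: x - T x = lambda *: y - T y -> x = y.
  move=> Tx Ty xy; apply/eqP; rewrite -subr_eq0 addrC -scaleN1r; apply/eqP.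
  have [? E] := Tlin (-1) y x Ty Tx; apply: Tinj => //.
  rewrite E scalerDr !scaleN1r scalerN addrC [RHS]addrC.
  rewrite -[T x](subKr (lambda *: x)) xy opprB -addrA.
  by rewrite [T y - _ - _]addrAC subrr sub0r.
have S0_linear : linear S0.
  move=> a x y; have [Sx Ex _] := S0P x; have [Sy Ey _] := S0P y.
  have [Sxy Exy _] := S0P (a *: x + y); have [Txy TE] := Tlin a _ _ Sx Sy.
  apply: uniq => //; rewrite Exy TE scalerDr scalerA mulrC -scalerA opprD addrACA.
  by rewrite -scalerBr Ex Ey.
pose S : {linear X -> X} := HB.pack S0 (GRing.isLinear.Build _ _ _ _ S0 S0_linear).
exists S; split.
- by exists M => y; have [] := S0P y.
- by move=> y; have [] := S0P y.
- by move=> x Tx; have [Sx E _] := S0P (lambda *: x - T x); exact: uniq.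
Qed.

End AbstractSpectrum.

(** * The spectrum of [A + L] in the half-plane *)

Section SpectralAnalysis.
Context {R : realType} {n : nat} {eta : R}.
Local Notation rc := (real_complex R).
Local Notation BUC_R := (BUC (real_scalars R) n eta).
Local Notation BUC_C := (BUC (complex_scalars R) n eta).
Local Notation state_C := (state (complex_scalars R) n eta).
Variable Lhat : {linear BUC_R -> 'cV[R]_n}.
Local Notation L := (complexify Lhat).

(** The domain of [A] lies in its closure, so adding [L] does not shrink it. *)
Lemma dom_AL (x : state_C) : dom (AL_op L) x <-> x.1 = 0 /\ BUC1 x.2.
Proof. by split=> [[]//|Ax]; split=> //; exact: subset_closure. Qed.

Lemma AL_appE (x : state_C) (psi : BUC_C) : has_deriv (complex_scalars R) x.2 psi ->
  AL_op L x = (- psi (nonpos0 R) + L x.2, psi).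
Proof.
move=> /BUC_derivE E.
by rewrite -[LHS]/(- BUC_deriv x.2 (nonpos0 R) + L x.2, BUC_deriv x.2 + 0) E addr0.
Qed.

Lemma AL_linear (a : R[i]) (x y : state_C) : dom (AL_op L) x -> dom (AL_op L) y ->
  dom (AL_op L) (a *: x + y) /\
  AL_op L (a *: x + y) = a *: AL_op L x + AL_op L y.
Proof.
move=> /(iffLR (dom_AL x))[x0 [f' df]] /(iffLR (dom_AL y))[y0 [g' dg]].
case: x y x0 y0 df dg => [x1 f] [y1 g] x0 y0 df dg.
rewrite /= in x0 y0 df dg; subst x1 y1.
have dfg : has_deriv (complex_scalars R) (a *: f + g) (a *: f' + g').
  exact: half_derivD (@half_deriv_scaler R _ a _ _ df) dg.
split.
  apply: (iffRL (dom_AL _)); split; first by rewrite /= scaler0 addr0.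
  by exists (a *: f' + g').
rewrite (AL_appE (x := (0, f)) df) (AL_appE (x := (0, g)) dg).
rewrite (AL_appE (x := a *: (0, f) + (0, g)) dfg) /=.
congr (_, _); rewrite complexify_linear.
rewrite -[_ (nonpos0 R)]/(a *: f' (nonpos0 R) + g' (nonpos0 R)).
rewrite -[RHS]/(a *: (- f' (nonpos0 R) + L f) + (- g' (nonpos0 R) + L g)).
by rewrite [in RHS]scalerDr scalerN opprD addrACA.
Qed.

Variables (lambda : R[i]) (lam : - eta < complex.Re lambda).

(** The second component of the eigenvalue equation is [f' = lambda f], which
    forces [f = e^(lambda .) f(0)]; the first component then reads
    [Delta (f 0) = 0]. *)
Lemma AL_eigen_exp (x : state_C) : dom (AL_op L) x -> AL_op L x = lambda *: x ->
  x = (0, exp_BUC eta lambda (x.2 (nonpos0 R))) /\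
  Delta Lhat lambda *m x.2 (nonpos0 R) = 0.
Proof.
move=> /(iffLR (dom_AL x))[x0 [f' df]].
case: x x0 df => [x1 f] x0 df; rewrite /= in x0 df; subst x1.
rewrite (AL_appE (x := (0, f)) df) /=.
case=> /= E1 E2; move: E1; rewrite scaler0 => E1.
have fE : f = exp_BUC eta lambda (f (nonpos0 R)).
  apply/val_inj; rewrite [RHS](exp_BUCE _ lam); apply: ode_unique.
  by rewrite E2 in df.
rewrite -fE; split=> //; rewrite Delta_mul// -fE.
by apply/eqP; rewrite -oppr_eq0 opprB addrC -[X in _ == X]E1 E2.
Qed.

(** [e^(lambda .) c] is an eigenvector of the part as well, because [A + L] maps it
    to a multiple of itself, which stays in the domain of [A]. *)
Lemma exp_eigenvector (c : 'cV[R[i]]_n) : c != 0 -> Delta Lhat lambda *m c = 0 ->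
  point_spectrum (AL0_op L) lambda.
Proof.
move=> c0 Dc; pose f := exp_BUC eta lambda c.
have df : has_deriv (complex_scalars R) f (lambda *: f) :=
  @exp_BUC_deriv R n eta lambda lam c.
have Ax : dom (AL_op L) (0, f).
  by apply: (iffRL (dom_AL _)); split=> //; exists (lambda *: f).
have AE : AL_op L (0, f) = lambda *: ((0, f) : state_C).
  rewrite (AL_appE (x := (0, f)) df); congr (_, _); rewrite scaler0.
  rewrite -[(lambda *: f) _]/(lambda *: f (nonpos0 R)) exp_BUC_at0//.
  by apply/eqP; rewrite addrC subr_eq0 eq_sym -subr_eq0 -Delta_mul// Dc.
exists (0, f); split; last exact: AE.
- split=> //; first by case: Ax.
  rewrite [X in closure _ X]AE; apply: subset_closure; split; first exact: scaler0.
  exists (lambda *: (lambda *: f)); exact: (@half_deriv_scaler R _ lambda _ _ df).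
- apply: contra_neq c0 => -[/(congr1 (fun g : BUC_C => g (nonpos0 R)))].
  by rewrite exp_BUC_at0.
Qed.

(** With [w] the solution of [w' = lambda w - psi] such that [w 0 = 0], every
    solution of [f' = lambda f - psi] is [f = e^(lambda .) c + w].  The first
    component of the resolvent equation with right-hand side [(alpha, psi)] is
    [f' 0 - L f = alpha], that is, [Delta c = alpha + psi 0 + L w]. *)
Lemma Delta_unit_resolvent : bounded_operator Lhat ->
  Delta Lhat lambda \in unitmx -> resolvent_set (AL_op L) lambda.
Proof.
move=> /complexify_bounded[M M0 LM] Du.
have [C C0 CP] := mulmx_bounded 1 (invmx (Delta Lhat lambda)).
pose b := rc (complex.Re lambda + eta)^-1.
have b0 : 0 <= b.
  by rewrite rc_ge0 invr_ge0 -lerBlDr sub0r ltW.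
(* [C] bounds the inverse of [Delta], [M] bounds [L], [b] bounds [psi |-> w]. *)
apply: (@resolvent_set_bounded_solution _ _ _ _ (C * (1 + M * b) + b)).
- exact: AL_linear.
- move=> x Ax /(AL_eigen_exp Ax)[xE Dx].
  have x20 : x.2 (nonpos0 R) = 0 by rewrite -(mulKmx Du (x.2 _)) Dx mulmx0.
  rewrite xE x20.
  congr (_, _); apply/val_inj; rewrite [LHS](exp_BUCE _ lam).
  by apply/funext => t; rewrite /exp_fun scaler0.
- move=> [alpha psi].
  have [w [w0 dw w_le]] := BUC_ode_solution psi lam.
  pose r := alpha + psi (nonpos0 R) + L w.
  pose c := invmx (Delta Lhat lambda) *m r.
  have Dc : Delta Lhat lambda *m c = r by rewrite mulKVmx.
  pose f := exp_BUC eta lambda c + w.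
  have df : has_deriv (complex_scalars R) f (lambda *: f - psi).
    have := half_derivD (@exp_BUC_deriv R n eta lambda lam c) dw.
    by rewrite /f scalerDr -addrA.
  exists (0, f); split.
  + by apply: (iffRL (dom_AL _)); split=> //; exists (lambda *: f - psi).
  + rewrite (AL_appE (x := (0, f)) df) /=; congr (_, _); last first.
      by rewrite /= opprB addrC subrK.
    rewrite /= scaler0 sub0r opprD opprK.
    have -> : L f = L (exp_BUC eta lambda c) + L w.
      by rewrite -[X in L (X + _)]scale1r complexify_linear scale1r.
    have f'E : (lambda *: f - psi) (nonpos0 R) = lambda *: c - psi (nonpos0 R).
      rewrite -[LHS]/(lambda *: (exp_BUC eta lambda c (nonpos0 R) + w (nonpos0 R))
                      - psi (nonpos0 R)).
      by rewrite exp_BUC_at0// w0 addr0.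
    rewrite -[X in X - _ = _]/((lambda *: f - psi) (nonpos0 R)) f'E.
    by rewrite addrAC opprD addrA -Delta_mul// Dc /r addrK addrK.
  + have psi0 : `|psi (nonpos0 R)| <= `|psi|.
      by have := BUC_norm_ge psi (nonpos0 R); rewrite /= mulr0 expR0 rmorph1 mul1r.
    set N : R[i] := `|(alpha, psi) : state_C|.
    have NE : N = `|alpha| + `|psi| by [].
    have psiN : `|psi| <= N by rewrite NE lerDr.
    have wN : `|w| <= b * N by rewrite (le_trans w_le)// ler_wpM2l.
    have rN : `|r| <= (1 + M * b) * N.
      rewrite /r (le_trans (ler_normD _ _))// mulrDl mul1r lerD//.
        by rewrite (le_trans (ler_normD _ _))// NE lerD.
      by rewrite (le_trans (LM _))// -mulrA ler_wpM2l.
    rewrite [leLHS](_ : _ = `|0 : 'cV[R[i]]_n| + `|f|)// normr0 add0r.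
    rewrite (le_trans (ler_normD _ _))// mulrDl lerD// (le_trans (exp_BUC_norm lam _))//.
    by rewrite (le_trans (CP _))// -mulrA ler_wpM2l.
Qed.

End SpectralAnalysis.

Theorem lemma4p5 (R : realType) (n : nat) (eta : R)
    (Lhat : {linear BUC (real_scalars R) n eta -> 'cV[R]_n}) :
  (0 < n)%N -> 0 < eta -> bounded_operator Lhat ->
  let Omega := [set lambda : R[i] | - eta < complex.Re lambda] in
  spectrum (AL_op (complexify Lhat)) `&` Omega
    = point_spectrum (AL0_op (complexify Lhat)) `&` Omega
  /\ point_spectrum (AL0_op (complexify Lhat)) `&` Omega
    = [set lambda | Omega lambda /\ \det (Delta Lhat lambda) = 0].
Proof.
move=> n0 eta0 Lb Omega.
have point_spec lambda : point_spectrum (AL0_op (complexify Lhat)) lambda ->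
    spectrum (AL_op (complexify Lhat)) lambda.
  move=> [x [[Ax _ _] x0 xE]]; apply: point_spectrum_sub_spectrum.
  by exists x.
have spec_det lambda : Omega lambda -> spectrum (AL_op (complexify Lhat)) lambda ->
    \det (Delta Lhat lambda) = 0.
  move=> lam sp; apply/eqP/negPn/negP => D0; apply: sp.
  by apply: Delta_unit_resolvent; rewrite // unitmxE unitfE.
have det_point lambda : Omega lambda -> \det (Delta Lhat lambda) = 0 ->
    point_spectrum (AL0_op (complexify Lhat)) lambda.
  move=> lam /eqP; rewrite -det_tr => /det0P[v v0 vD].
  apply: (@exp_eigenvector _ _ _ _ _ lam v^T).
    by apply: contra_neq v0 => /(congr1 trmx); rewrite trmxK trmx0.
  by rewrite -[LHS]trmxK trmx_mul trmxK vD trmx0.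
split; apply/seteqP; split=> lambda /=.
- by move=> [sp lam]; split=> //; apply: det_point => //; exact: spec_det.
- by move=> [/point_spec].
- by move=> [/point_spec sp lam]; split=> //; exact: spec_det.
- by move=> [lam D0]; split=> //; exact: det_point.
Qed.
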